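(* Let $G$ be a graph with diameter $\mathrm{diam}(G)=2$ and minimum degree $\delta(G)$. Then $\gamma_t(G) \leq \delta(G)+1$.
   Context: Graphs are finite, simple and undirected. A set $S$ of vertices in a graph $G=(V,E)$ is called a total dominating set if every vertex $v\in V$ (including those in $S$) is adjacent to some element of $S$. The total domination number $\gamma_t(G)$ is the minimum cardinality of a total dominating set of $G$. The diameter is the maximum distance between two vertices; a graph of diameter $2$ is in particular connected. *)

(* Defs.v *)
From mathcomp Require Import all_boot.
Set Implicit Arguments.
Unset Strict Implicit.
Unset Printing Implicit Defensive.

(* A finite simple undirected graph is a symmetric irreflexive adjacency
   relation [e] on a finite vertex type [T].  A minimum below is an iterated
   [minn] whose initial value is larger than every value that can be attained
   in such a graph, so it is returned only for an empty family. *)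
Section Graph.
Variables (T : finType) (e : rel T).

Definition degree (v : T) : nat := #|[set u | e v u]|.

(* A degree is at most #|T| - 1. *)
Definition min_degree : nat := \big[minn/#|T|]_(v : T) degree v.

Definition walk (n : nat) (x y : T) : bool :=
  [exists p : n.-tuple T, path e x p && (last x p == y)].

(* A shortest walk between connected vertices has length at most #|T| - 1. *)
Definition dist (x y : T) : nat := \big[minn/#|T|]_(n < #|T| | walk n x y) n.

Definition connected : bool := [forall x, forall y, connect e x y].

(* [None] stands for the infinite diameter of a disconnected graph. *)
Definition diameter : option nat :=
  if connected then Some (\max_(x : T) \max_(y : T) dist x y) else None.

Definition total_dominating (S : {set T}) : bool :=
  [forall v, [exists u in S, e v u]].

(* The value #|T| + 1 means that there is no total dominating set, i.e. that
   some vertex is isolated. *)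
Definition total_domination_number : nat :=
  \big[minn/#|T|.+1]_(S : {set T} | total_dominating S) #|S|.

End Graph.

(* Main.v *)
Require Import Defs.
From mathcomp Require Import all_boot.

(** Let [v] be a vertex of minimum degree.  Its closed neighbourhood has
    [min_degree e + 1] elements, and it is totally dominating: since the
    diameter is 2, a vertex [u] other than [v] is either adjacent to [v] or
    shares a neighbour with [v], and [v] itself has a neighbour because the
    graph is connected with more than one vertex
    ([total_dominating_closed_neighborhood]).

    The distance is an iterated [minn] with the default value [#|T|], so it
    gives a walk only once this default is excluded.  [connect_walk] does that:
    removing the loops of a path leaves fewer than [#|T|] edges.  The resulting
    bound [dist_lt_card] also shows that diameter 2 forces at least three
    vertices ([diameter_lt_card]), hence a vertex other than [v]. *)

Section IteratedMin.
Variables (I : Type) (P : pred I) (F : I -> nat) (d : nat).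

Lemma leq_bigmin m (r : seq I) :
    m <= d -> (forall i, P i -> m <= F i) ->
  m <= \big[minn/d]_(i <- r | P i) F i.
Proof.
move=> m_le_d m_le_F; elim/big_ind: _ => // a b m_le_a m_le_b.
by rewrite leq_min m_le_a.
Qed.

Lemma bigmin_eq_default_or_attained (r : seq I) :
  \big[minn/d]_(i <- r | P i) F i = d \/
  exists2 i, P i & \big[minn/d]_(i <- r | P i) F i = F i.
Proof.
elim/big_rec: _ => [|i m Pi IHm]; first by left.
by case: (leqP (F i) m) => _; [right; exists i | exact: IHm].
Qed.

End IteratedMin.

Lemma bigmin_leq (I : finType) (P : pred I) (F : I -> nat) d i :
  P i -> \big[minn/d]_(j | P j) F j <= F i.
Proof.
move=> Pi; have := mem_index_enum i.
elim: (index_enum I) => [//|j r IHr]; rewrite inE big_cons => /orP[/eqP<-|ir].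
  by rewrite Pi geq_minl.
by case: (P j); rewrite ?geq_min IHr ?orbT.
Qed.

Section Distance.
Variables (T : finType) (e : rel T).
Implicit Types x y : T.

Lemma connect_walk x y :
  connect e x y -> exists2 n, n < #|T| & walk e n x y.
Proof.
case/connectP=> p ep ->; case/shortenP: ep => q eq uq _.
exists (size q); first by have /card_uniqP/= <- := uq; exact: max_card.
by apply/existsP; exists (in_tuple q); rewrite eq /=.
Qed.

Lemma dist_lt_card x y : connect e x y -> dist e x y < #|T|.
Proof.
case/connect_walk=> n n_lt wn; apply: leq_ltn_trans (n_lt).
exact: (@bigmin_leq _ _ (fun k : 'I__ => k : nat) _ (Ordinal n_lt)).
Qed.

Lemma walk_dist x y : connect e x y -> walk e (dist e x y) x y.
Proof.
move=> /dist_lt_card dist_lt.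
have [dist_default | [n wn dist_n]] := bigmin_eq_default_or_attained
  _ (fun n : 'I_#|T| => walk e n x y) (fun n => n : nat) #|T| (index_enum _).
  by rewrite /dist dist_default ltnn in dist_lt.
by rewrite /dist dist_n.
Qed.

Lemma diameter_connect d x y : diameter e = Some d -> connect e x y.
Proof.
by rewrite /diameter; case: ifP => // /forallP/(_ x)/forallP/(_ y).
Qed.

Lemma dist_leq_diameter d x y : diameter e = Some d -> dist e x y <= d.
Proof.
rewrite /diameter; case: ifP => // _ [<-].
apply: leq_trans (leq_bigmax x).
exact: (leq_bigmax y).
Qed.

(** A positive diameter rules out the empty graph, in which no distance is
    available to be bounded by [dist_lt_card]. *)
Lemma diameter_lt_card d : 0 < d -> diameter e = Some d -> d < #|T|.
Proof.
move=> d_gt0 diam_d; have conn := diameter_connect d _ _ diam_d.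
move: diam_d d_gt0; rewrite /diameter; case: ifP => // _ [<-] max_gt0.
have [x _] : exists x : T, true.
  apply/existsP; apply: contraLR max_gt0 => /existsPn noT.
  by rewrite big1 // => x; have := noT x.
have T_gt0 : 0 < #|T| by apply/card_gt0P; exists x.
rewrite -(prednK T_gt0) ltnS; apply/bigmax_leqP => y _; apply/bigmax_leqP => z _.
by rewrite -ltnS (prednK T_gt0) dist_lt_card.
Qed.

(** Only a walk of length 0 fails to leave [x], and such a walk ends at [x]. *)
Lemma connect_neighbor x y : connect e x y -> x != y -> exists z, e x z.
Proof.
case/connectP=> [[|z p] /= ep ->]; first by rewrite eqxx.
by case/andP: ep => exz _; exists z.
Qed.

Lemma diameter2_adjacent_or_common x y :
    diameter e = Some 2 -> x != y ->
  e x y \/ exists2 z, e x z & e z y.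
Proof.
move=> diam2 neq_xy.
have := walk_dist x y (diameter_connect 2 x y diam2).
have := dist_leq_diameter 2 x y diam2.
case: (dist e x y) => [|[|[|//]]] _ /existsP[p /andP[]].
- by rewrite tuple0 /= (negPf neq_xy).
- by case/tupleP: p => z p; rewrite tuple0 /= andbT => exz /eqP<-; left.
case/tupleP: p => z p; case/tupleP: p => w p; rewrite tuple0 /= andbT.
by case/andP=> exz ezw /eqP<-; right; exists z.
Qed.

Lemma exists_degree_leq_min_degree : 0 < #|T| ->
  exists v, degree e v <= min_degree e.
Proof.
case/card_gt0P=> x0 _; case: (arg_minnP (degree e) (erefl (xpredT x0))) => v _ v_min.
exists v; apply: leq_bigmin => [|u _]; last exact: v_min.
exact: max_card.
Qed.

(** Total domination asks that [v] too be adjacent to the set, so [u = v] is a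
    case of its own: there a walk from [v] to another vertex is used. *)
Lemma total_dominating_closed_neighborhood v :
    symmetric e -> diameter e = Some 2 ->
  total_dominating e (v |: [set u | e v u]).
Proof.
move=> e_sym diam2; apply/forallP=> u; apply/exists_inP.
have [->|neq_uv] := eqVneq u v.
  have [w neq_wv] : exists w, w != v.
    have := diameter_lt_card 2 isT diam2.
    rewrite -cardsT (cardsD1 v) inE ltnS => /ltnW/card_gt0P[w].
    by rewrite !inE andbT; exists w.
  rewrite eq_sym in neq_wv.
  have [z evz] := connect_neighbor v w (diameter_connect 2 v w diam2) neq_wv.
  by exists z; rewrite // !inE evz orbT.
have [euv | [z euz ezv]] := diameter2_adjacent_or_common u v diam2 neq_uv.
  by exists v; rewrite ?setU11.
by exists z; rewrite // !inE [e v z]e_sym ezv orbT.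
Qed.

End Distance.

Theorem theorem2 (T : finType) (e : rel T)
    (e_sym : symmetric e) (e_irr : irreflexive e)
    (diam2 : diameter e = Some 2) :
  total_domination_number e <= min_degree e + 1.
Proof.
have T_gt0 : 0 < #|T| := ltnW (ltnW (diameter_lt_card _ e 2 isT diam2)).
have [v v_min] := exists_degree_leq_min_degree _ e T_gt0.
have dom := total_dominating_closed_neighborhood _ e v e_sym diam2.
apply: leq_trans (bigmin_leq _ _ (fun S : {set T} => #|S|) _ _ dom) _.
by rewrite cardsU1 inE e_irr addnC leq_add2r.
Qed.
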